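(* Let $H_X\in\mathbb{F}_2^{m_X\times n}$, $H_Z\in\mathbb{F}_2^{m_Z\times n}$ with $H_XH_Z^{\top}=0$ define a CSS code with at least one nontrivial stabilizer and at least one nontrivial logical operator, and let $\bm w=(w_1,\dots,w_n)$ be the per-qubit directional weights arising from nonnegative edge weight matrices $D_X,D_Z$. Let $w_{\min}=\min_i w_i$ and $w_{\max}=\max_i w_i$. Let $d$ be the Hamming distance of the code (the minimum Hamming weight of a nontrivial logical operator) and $d_{\mathrm S}$ the minimum Hamming weight among nontrivial stabilizers. Let $d_{\bm w}^{\mathrm S}$ be the minimum directional cost $\Delta_{\bm w}$ among nontrivial stabilizers and $d_{\bm w}^{\mathrm L}$ the minimum directional cost $\Delta_{\bm w}$ among nontrivial logical operators. Then $$w_{\min}\,d_{\mathrm S}\le d_{\bm w}^{\mathrm S}\le w_{\max}\,d_{\mathrm S},\qquad w_{\min}\,d\le d_{\bm w}^{\mathrm L}\le w_{\max}\,d.$$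
   Context: CSS code: $H_X,H_Z$ are binary matrices with $H_XH_Z^\top=0$ over $\mathbb{F}_2$; $S_X$ and $S_Z$ are the row spaces of $H_X$ and $H_Z$; $C_X=\ker H_X$, $C_Z=\ker H_Z$ (subspaces of $\mathbb{F}_2^n$), so that $S_X\subseteq C_Z$ and $S_Z\subseteq C_X$. Nontrivial stabilizers are the nonzero vectors of $S_X\cup S_Z$. Nontrivial logical operators are the vectors in $(C_Z\setminus S_X)\cup(C_X\setminus S_Z)$ ($X$-type and $Z$-type respectively). Directional weights: one is given real matrices $D_X\in\mathbb{R}_{\ge0}^{n\times m_X}$, $D_Z\in\mathbb{R}_{\ge0}^{n\times m_Z}$, with $D_X(i,j)$ (resp. $D_Z(i,j)$) nonzero only if qubit $i$ is adjacent to $X$-check $j$ (resp. $Z$-check $j$), i.e. only if $H_X(j,i)=1$ (resp. $H_Z(j,i)=1$). With $N_X(i)=\{j: H_X(j,i)=1\}$ and $N_Z(i)=\{j:H_Z(j,i)=1\}$, put $w_i=\sum_{j\in N_X(i)}D_X(i,j)+\sum_{j\in N_Z(i)}D_Z(i,j)\ge 0$. Directional cost: for $E\in\{0,1\}^n$ (identified with $\mathbb{F}_2^n$), $\Delta_{\bm w}(E)=\sum_{i=1}^n w_iE_i$, the sum taken over the reals. *)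

(* Defs.v *)
From mathcomp Require Import all_boot all_order all_algebra.
From mathcomp Require Import reals.

Set Implicit Arguments.
Unset Strict Implicit.
Unset Printing Implicit Defensive.

Import Order.TTheory GRing.Theory Num.Theory.
Local Open Scope ring_scope.

(* Attained minimum and maximum of f over a finite set A; the value y0 is
   returned only when A is empty. *)
Definition min_over disp (T : orderType disp) (I : finType) (y0 : T)
    (A : {set I}) (f : I -> T) : T :=
  if [pick x in A] is Some x0 then f [arg min_(x < x0 in A) f x]%O else y0.

Definition max_over disp (T : orderType disp) (I : finType) (y0 : T)
    (A : {set I}) (f : I -> T) : T :=
  if [pick x in A] is Some x0 then f [arg max_(x > x0 in A) f x]%O else y0.

Section CSS.
Variables (n mX mZ : nat) (HX : 'M['F_2]_(mX, n)) (HZ : 'M['F_2]_(mZ, n)).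

(* Vectors of F_2^n are row vectors; ker H is therefore the right kernel
   {v | H v^T = 0}, not the left kernel given by kermx. *)
Definition row_space m (H : 'M['F_2]_(m, n)) : {set 'rV['F_2]_n} :=
  [set v | (v <= H)%MS].

Definition right_kernel m (H : 'M['F_2]_(m, n)) : {set 'rV['F_2]_n} :=
  [set v : 'rV['F_2]_n | H *m v^T == 0].

Definition nontrivial_stabilizers : {set 'rV['F_2]_n} :=
  (row_space HX :|: row_space HZ) :\ 0.

Definition nontrivial_logicals : {set 'rV['F_2]_n} :=
  (right_kernel HZ :\: row_space HX) :|: (right_kernel HX :\: row_space HZ).

Definition hamming_weight (E : 'rV['F_2]_n) : nat := #|[set i | E 0 i != 0]|.

Definition stabilizer_distance : nat :=
  min_over 0%N nontrivial_stabilizers hamming_weight.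

Definition code_distance : nat :=
  min_over 0%N nontrivial_logicals hamming_weight.

Variable R : realType.

(* D i j is the weight of the edge between qubit i and check j, so its indices
   are transposed with respect to those of H. *)
Definition edge_weights m (H : 'M['F_2]_(m, n)) (D : 'M[R]_(n, m)) : Prop :=
  (forall i j, 0 <= D i j) /\ (forall i j, D i j != 0 -> H j i = 1).

Definition qubit_weight (DX : 'M[R]_(n, mX)) (DZ : 'M[R]_(n, mZ)) (i : 'I_n)
    : R :=
  \sum_(j | HX j i == 1) DX i j + \sum_(j | HZ j i == 1) DZ i j.

(* The representative 0 or 1 of E 0 i in nat is cast into R, so that the sum
   is over the reals and not modulo 2. *)
Definition directional_cost (w : 'I_n -> R) (E : 'rV['F_2]_n) : R :=
  \sum_(i < n) w i * (E 0 i : nat)%:R.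

Definition stabilizer_cost_distance (w : 'I_n -> R) : R :=
  min_over 0 nontrivial_stabilizers (directional_cost w).

Definition logical_cost_distance (w : 'I_n -> R) : R :=
  min_over 0 nontrivial_logicals (directional_cost w).

End CSS.

Definition weight_min (R : realType) n (w : 'I_n -> R) : R :=
  min_over 0 [set: 'I_n] w.

Definition weight_max (R : realType) n (w : 'I_n -> R) : R :=
  max_over 0 [set: 'I_n] w.

(* Main.v *)
(* The cost is squeezed vector by vector, [w_min |E| <= Delta_w E <= w_max |E|].
   The squeeze passes to minima over any nonempty set of vectors: for the upper
   bound evaluate at a vector of least weight, for the lower bound at a vector of
   least cost, using [0 <= w_min]. *)
Require Import Defs.
From mathcomp Require Import all_boot all_order all_algebra.
From mathcomp Require Import reals.
Import Order.TTheory GRing.Theory Num.Theory.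
Local Open Scope ring_scope.

Section Extrema.
Context {disp : Order.disp_t} {T : orderType disp} {I : finType}.
Implicit Types (A : {set I}) (f : I -> T).

Lemma min_over_attained (y0 : T) A f : A != set0 ->
  exists2 x, x \in A & min_over y0 A f = f x.
Proof.
rewrite /min_over; case: pickP => [x0 x0A _ | A0]; last first.
  by case/set0Pn => x; rewrite A0.
by case: arg_minP => // x xA _; exists x.
Qed.

Lemma min_over_le (y0 : T) A f x : x \in A -> (min_over y0 A f <= f x)%O.
Proof.
rewrite /min_over; case: pickP => [x0 x0A xA | A0]; last by rewrite A0.
by case: arg_minP => // y _; apply.
Qed.

Lemma max_over_ge (y0 : T) A f x : x \in A -> (f x <= max_over y0 A f)%O.
Proof.
rewrite /max_over; case: pickP => [x0 x0A xA | A0]; last by rewrite A0.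
by case: arg_maxP => // y _; apply.
Qed.

(** The bound on [y0] covers an empty [A], where the default value is returned. *)
Lemma le_min_over (y0 c : T) A f :
  (c <= y0)%O -> (forall x, x \in A -> (c <= f x)%O) ->
  (c <= min_over y0 A f)%O.
Proof.
move=> cy0 cf; rewrite /min_over; case: pickP => // x0 x0A.
by case: arg_minP => // x xA _; apply: cf.
Qed.

End Extrema.

Lemma min_over_squeeze (R : realType) (I : finType) (A : {set I})
    (h : I -> nat) (f : I -> R) (a b : R) :
  A != set0 -> 0 <= a ->
  (forall x, a * (h x)%:R <= f x <= b * (h x)%:R) ->
  a * (min_over 0%N A h)%:R <= min_over 0 A f /\
  min_over 0 A f <= b * (min_over 0%N A h)%:R.
Proof.
move=> A0 a0 hf; split.
  have [y yA ->] := min_over_attained 0 A f A0.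
  have /andP[+ _] := hf y; apply: le_trans.
  (* [leEnat] passes from [leq] to the generic order in which [min_over_le] is stated. *)
  by rewrite ler_wpM2l // ler_nat -leEnat min_over_le.
have [x xA ->] := min_over_attained 0%N A h A0.
have /andP[_] := hf x; apply: le_trans; exact: min_over_le.
Qed.

Section Weights.
Context {R : realType} {n : nat}.
Implicit Type w : 'I_n -> R.

Lemma F2_natE (x : 'F_2) : (x : nat) = (x != 0).
(* ['F_2] computes to the ordinals below 2, so [k.+2] contradicts its bound. *)
Proof. by case: x => [[|[|k]] lt_k2]. Qed.

(** This puts the weight in the shape of a directional cost with all weights 1, so that the two can
    be compared qubit by qubit. *)
Lemma hamming_weightE (E : 'rV['F_2]_n) :
  (hamming_weight E)%:R = \sum_(i < n) (E 0 i : nat)%:R :> R.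
Proof.
rewrite -natr_sum /hamming_weight -sum1_card big_mkcond /=; congr _%:R.
by apply: eq_bigr => i _; rewrite inE F2_natE; case: eqP.
Qed.

Lemma directional_cost_bounds w (E : 'rV['F_2]_n) :
  weight_min w * (hamming_weight E)%:R <= directional_cost w E
    <= weight_max w * (hamming_weight E)%:R.
Proof.
(* With the constants moved inside the sums, each term only needs
   [weight_min w <= w i <= weight_max w], scaled by an entry that is nonnegative as a cast natural
   number. *)
rewrite hamming_weightE !mulr_sumr.
by apply/andP; split; apply: ler_sum => i _; rewrite ler_wpM2r ?ler0n //;
  [apply: min_over_le | apply: max_over_ge].
Qed.

Lemma qubit_weight_ge0 mX mZ (HX : 'M['F_2]_(mX, n)) (HZ : 'M['F_2]_(mZ, n))
    (DX : 'M[R]_(n, mX)) (DZ : 'M[R]_(n, mZ)) i :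
  edge_weights HX DX -> edge_weights HZ DZ -> 0 <= qubit_weight HX HZ DX DZ i.
Proof. by move=> [DX0 _] [DZ0 _]; rewrite addr_ge0 // sumr_ge0. Qed.

End Weights.

Theorem proposition2 (R : realType) (n mX mZ : nat)
    (HX : 'M['F_2]_(mX, n)) (HZ : 'M['F_2]_(mZ, n))
    (DX : 'M[R]_(n, mX)) (DZ : 'M[R]_(n, mZ))
    (hCSS : HX *m HZ^T = 0)
    (hS : nontrivial_stabilizers HX HZ != set0)
    (hL : nontrivial_logicals HX HZ != set0)
    (hDX : edge_weights HX DX) (hDZ : edge_weights HZ DZ) :
  let w := qubit_weight HX HZ DX DZ in
  let d := code_distance HX HZ in
  let dS := stabilizer_distance HX HZ in
  let dwS := stabilizer_cost_distance HX HZ w in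
  let dwL := logical_cost_distance HX HZ w in
  (weight_min w * dS%:R <= dwS /\ dwS <= weight_max w * dS%:R) /\
  (weight_min w * d%:R <= dwL /\ dwL <= weight_max w * d%:R).
Proof.
move=> w d dS dwS dwL.
have wmin0 : 0 <= weight_min w.
  (* If [n = 0], the minimum is the default 0 and the bound still holds. *)
  by apply: le_min_over => // i _; apply: qubit_weight_ge0.
by split; apply: min_over_squeeze => // E; apply: directional_cost_bounds.
Qed.
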